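(* Let $n\ge 1$ and let $\overrightarrow{G}=([n],E)$ be any directed graph with vertex set $[n]=\{1,\dots,n\}$, and let $G$ be its underlying undirected graph. Then $$\omega X_{\overrightarrow{G}}(\mathbf{x},t)=\sum_{\sigma\in\mathfrak{S}_n}F_{n,\mathrm{DES}_G(\sigma)}(\mathbf{x})\,t^{\mathrm{inv}_{\overrightarrow{G}}(\sigma)}.$$
   Context: Digraphs are simple (no loops, no repeated directed edges); $(i,j)\in E$ is an edge directed from $i$ to $j$. The underlying undirected graph $G$ has an edge $\{i,j\}$ iff $(i,j)\in E$ or $(j,i)\in E$. A proper coloring of $\overrightarrow{G}$ is a map $\kappa:V\to\mathbb{P}=\{1,2,3,\dots\}$ with $\kappa(u)\ne\kappa(v)$ whenever $u,v$ are adjacent. Its ascent number is $\mathrm{asc}(\kappa)=|\{(u,v)\in E:\kappa(u)<\kappa(v)\}|$. The chromatic quasisymmetric function is $$X_{\overrightarrow{G}}(\mathbf{x},t)=\sum_{\kappa}t^{\mathrm{asc}(\kappa)}\prod_{v\in V}x_{\kappa(v)},$$ the sum over all proper colorings $\kappa$; it is a polynomial in $t$ with coefficients in the ring $\mathrm{QSym}_{\mathbb{Q}}$ of quasisymmetric functions in $x_1,x_2,\dots$. For $S\subseteq[n-1]$, Gessel's fundamental quasisymmetric function is $F_{n,S}(\mathbf{x})=\sum x_{i_1}x_{i_2}\cdots x_{i_n}$, summed over $i_1\ge i_2\ge\cdots\ge i_n\ge1$ with $i_j>i_{j+1}$ for all $j\in S$. The map $\omega$ is the linear involution on $\mathrm{QSym}_{\mathbb{Q}}$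 with $\omega(F_{n,S})=F_{n,[n-1]\setminus S}$ (it restricts to the usual involution $\omega$ on symmetric functions), extended to $\mathrm{QSym}_{\mathbb{Q}}[t]$ coefficientwise in $t$. For $\sigma=\sigma_1\cdots\sigma_n\in\mathfrak{S}_n$: $\mathrm{inv}_{\overrightarrow{G}}(\sigma)=|\{(i,j)\in E:\sigma^{-1}(j)<\sigma^{-1}(i)\}|$, i.e. the number of directed edges $i\to j$ such that $j$ appears before $i$ in $\sigma$. For $x\in[n]$, $\mathrm{rank}_{(G,\sigma)}(x)$ is the length $k$ of the longest subword $\sigma_{i_1}\sigma_{i_2}\cdots\sigma_{i_k}$ with $i_1<\cdots<i_k$, $\sigma_{i_k}=x$, and $\{\sigma_{i_j},\sigma_{i_{j+1}}\}$ an edge of $G$ for each $1\le j<k$. For $1\le i\le n-1$, $\sigma$ has a $G$-descent at $i$ if either $\mathrm{rank}_{(G,\sigma)}(\sigma_i)>\mathrm{rank}_{(G,\sigma)}(\sigma_{i+1})$, or these ranks are equal and $\sigma_i>\sigma_{i+1}$. $\mathrm{DES}_G(\sigma)$ is the set of $G$-descents of $\sigma$. *)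

(* Defs.v *)
From HB Require Import structures.
From mathcomp Require Import all_boot all_order all_algebra all_fingroup finmap.
From mathcomp Require Import all_classical zify.
From mathcomp.multinomials Require Import monalg.

Set Implicit Arguments.
Unset Strict Implicit.
Unset Printing Implicit Defensive.

Import GRing.Theory.

Local Open Scope ring_scope.

(* The index k : nat stands for the positive integer k + 1: colors range over
   nat and U_(k) is the variable x_{k+1}.  Only the order of the indices
   matters below. *)
Notation "'U_(' k )" := (@ucm nat k) : monom_scope.

Definition mono n (w : {ffun 'I_n -> nat}) : {cmonom nat} :=
  \big[mmul/mone]_(v < n) U_(w v)%M.

Definition xpow k (i a : k.-tuple nat) : {cmonom nat} :=
  \big[mmul/mone]_(l < k) expcmn U_(tnth i l)%M (tnth a l).

Definition mseq (s : seq nat) : {cmonom nat} :=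
  \big[mmul/mone]_(x <- s) U_(x)%M.

Lemma mseqE s x : mseq s x = count_mem x s.
Proof.
rewrite /mseq; elim: s => [|y s IHs]; first by rewrite big_nil cm1.
by rewrite big_cons cmM cmU IHs.
Qed.

Lemma mseqP s s' : reflect (mseq s = mseq s') (perm_eq s s').
Proof.
apply: (iffP idP) => [/seq.permP ss'|eq_ss'].
  by apply/eqP/cmP => x; rewrite !mseqE ss'.
by apply/allP => x _ /=; rewrite -!mseqE eq_ss'.
Qed.

Lemma mdeg_mseq s : mdeg (mseq s) = size s.
Proof.
by rewrite /mseq mdeg_prod (eq_bigr (fun=> 1%N)) ?sum1_size // => x _; rewrite mdegU.
Qed.

Definition word n (w : {ffun 'I_n -> nat}) : seq nat := [seq w v | v <- enum 'I_n].

Lemma monoE n (w : {ffun 'I_n -> nat}) : mono w = mseq (word w).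
Proof. by rewrite /mono /mseq big_map big_enum. Qed.

Lemma size_word n (w : {ffun 'I_n -> nat}) : size (word w) = n.
Proof. by rewrite size_map size_enum_ord. Qed.

Lemma mdeg_mono n (w : {ffun 'I_n -> nat}) : mdeg (mono w) = n.
Proof. by rewrite monoE mdeg_mseq size_word. Qed.

Lemma mem_word n (w : {ffun 'I_n -> nat}) v : w v \in word w.
Proof. by apply: map_f; rewrite mem_enum. Qed.

Definition xword k (i a : k.-tuple nat) : seq nat :=
  flatten [seq nseq (tnth a l) (tnth i l) | l <- enum 'I_k].

Lemma xpowE k (i a : k.-tuple nat) : xpow i a = mseq (xword i a).
Proof.
rewrite /xpow /mseq /xword big_flatten big_map big_enum /=.
apply: eq_bigr => l _; rewrite /expcmn.
elim: (tnth a l) => [|b IHb] /=; first by rewrite big_nil.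
rewrite big_cons -IHb; case: b {IHb} => //=.
by rewrite mulm1.
Qed.

Lemma xword_map k (i a : k.-tuple nat) (phi : nat -> nat) :
  xword (map_tuple phi i) a = map phi (xword i a).
Proof.
rewrite /xword map_flatten -map_comp; congr flatten.
by apply: seq.eq_map => l /=; rewrite map_nseq tnth_map.
Qed.

Lemma finite_mono n m : finite_set [set w : {ffun 'I_n -> nat} | mono w = m].
Proof.
pose h (g : {ffun 'I_n -> finsupp m}) : {ffun 'I_n -> nat} := [ffun v => val (g v)].
apply: (@sub_finite_set _ _ (h @` setT)); last exact/finite_image/finite_finset.
move=> w /= wm.
have wv v : w v \in finsupp m.
  by rewrite -wm -cmE_neq0 monoE mseqE -lt0n -has_count has_pred1 mem_word.
exists [ffun v => FSetSub (wv v)] => //.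
by apply/ffunP => v; rewrite !ffunE.
Qed.

(* R^o is R as a module over itself: it gives pseries R the module structure
   of functions. *)
Notation pseries R := ({cmonom nat} -> R^o).

Section PowerSeries.
Variable R : comNzRingType.

(* The formal sum of c(w) x_{w(0)} ... x_{w(n-1)} over w in A, given by its
   coefficients; each of them is a finite sum by finite_mono. *)
Definition psum n (A : set {ffun 'I_n -> nat}) (c : {ffun 'I_n -> nat} -> R) :
    {cmonom nat} -> R :=
  fun m => \sum_(w \in (A `&` [set w | mono w = m])%classic) c w.

Definition quasisymmetric (f : {cmonom nat} -> R) : Prop :=
  forall k (a i j : k.-tuple nat),
    all (ltn 0) a -> sorted ltn i -> sorted ltn j -> f (xpow i a) = f (xpow j a).

Definition bounded_degree (f : {cmonom nat} -> R) : Prop :=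
  exists d, forall m, (d < mdeg m)%N -> f m = 0.

Definition qsym_pred : {pred pseries R} :=
  [pred f | `[< quasisymmetric f /\ bounded_degree f >]].

Lemma qsym_predP f :
  reflect (quasisymmetric f /\ bounded_degree f) (f \in qsym_pred).
Proof. exact: asboolP. Qed.

Lemma qsym_submod : submod_closed qsym_pred.
Proof.
split=> [|c f g].
  by apply/qsym_predP; split=> [//|]; exists 0%N.
move=> /qsym_predP[fq [d fd]] /qsym_predP[gq [e ge]]; apply/qsym_predP; split.
  move=> k a i j a0 si sj.
  by rewrite /GRing.add /= /GRing.scale /= (fq _ _ _ j) // (gq _ _ _ j).
exists (maxn d e) => m; rewrite gtn_max => /andP[dm em].
by rewrite /GRing.add /= /GRing.scale /= fd // ge // scaler0 addr0.
Qed.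

HB.instance Definition _ :=
  GRing.isSubmodClosed.Build R (pseries R) qsym_pred qsym_submod.

Record qsym := Qsym {
  qsym_val : pseries R;
  _ : qsym_val \in qsym_pred }.

HB.instance Definition _ := [isSub for qsym_val].
HB.instance Definition _ := [Choice of qsym by <:].
HB.instance Definition _ := [SubChoice_isSubLmodule of qsym by <:].

Definition qcoef (f : qsym) : {cmonom nat} -> R := qsym_val f.

Coercion qcoef : qsym >-> Funclass.
Arguments qcoef : simpl never.

Lemma qsym_quasisymmetric (f : qsym) : quasisymmetric f.
Proof. by have /qsym_predP[] := valP f. Qed.

Lemma qsym_bounded (f : qsym) : bounded_degree f.
Proof. by have /qsym_predP[] := valP f. Qed.

Lemma qsymP (f g : qsym) : (forall m, f m = g m) -> f = g.
Proof. by move=> fg; apply: val_inj; apply/funext. Qed.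

Lemma qsym0E m : (0 : qsym) m = 0. Proof. by []. Qed.
Lemma qsymDE (f g : qsym) m : (f + g) m = f m + g m. Proof. by []. Qed.
Lemma qsymZE c (f : qsym) m : (c *: f) m = c * f m. Proof. by []. Qed.

Lemma qsym_sumE I (r : seq I) (P : pred I) (F : I -> qsym) m :
  (\sum_(i <- r | P i) F i) m = \sum_(i <- r | P i) F i m.
Proof. exact: (big_morph (fun f : qsym => f m)). Qed.

(* Words with the same relative order have equal coefficients. *)
Lemma qsym_order (f : qsym) n (w w' : {ffun 'I_n -> nat}) :
  (forall u v, (w u < w v)%N = (w' u < w' v)%N) -> f (mono w) = f (mono w').
Proof.
move=> ww'; have fq := qsym_quasisymmetric f.
have eqw u v : (w u == w v) = (w' u == w' v).
  by rewrite !eqn_leq (leqNgt (w u)) (leqNgt (w v)) (leqNgt (w' u)) (leqNgt (w' v)) !ww'.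
pose phi x := if [pick v | w v == x] is Some v then w' v else 0%N.
have phiE v : phi (w v) = w' v.
  rewrite /phi; case: pickP => [u|/(_ v)]; last by rewrite eqxx.
  by rewrite eqw => /eqP.
pose i := in_tuple (sort leq (undup (word w))).
pose a := map_tuple (fun x => count_mem x (word w)) i.
have mem_i x : (x \in i) = (x \in word w) by rewrite mem_sort mem_undup.
have ui : uniq i by rewrite sort_uniq undup_uniq.
have si : sorted ltn i.
  by rewrite ltn_sorted_uniq_leq ui sort_sorted //; exact: leq_total.
have wx : perm_eq (word w) (xword i a).
  apply/allP => x _ /=; rewrite /xword count_flatten -map_comp sumnE big_map.
  rewrite big_enum /= (eq_bigr (fun l => (tnth i l == x) * count_mem x (word w))%N);
    last first.
    by move=> l _; rewrite /= count_nseq /= tnth_map; case: eqP => [->|_].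
  have [xi|xi] := boolP (x \in i).
    have /tnthP[l ->] := xi; rewrite (bigD1 l) //= eqxx mul1n big1 ?addn0 // => l' l'l.
    by rewrite (inj_eq (tuple_uniqP _ ui)) (negPf l'l).
  rewrite big1 => [|l _].
    by rewrite eqn0Ngt -has_count has_pred1 -mem_i.
  by case: eqP => // xE; rewrite -xE mem_tnth in xi.
have wx' : perm_eq (word w') (xword (map_tuple phi i) a).
  rewrite xword_map; have -> : word w' = map phi (word w).
    by rewrite /word -[RHS]map_comp; apply: seq.eq_map => v /=; rewrite phiE.
  exact: perm_map.
rewrite !monoE; move/mseqP: wx => ->; move/mseqP: wx' => ->.
rewrite -!xpowE; apply: fq => //.
- apply/allP => _ /mapP[x xi ->].
  by rewrite /= -has_count has_pred1 -mem_i.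
- have ii : all (mem i) i by apply/allP.
  rewrite /= sorted_map; apply: sub_in_sorted ii si => x y.
  rewrite !mem_i => /mapP[u _ ->] /mapP[v _ ->].
  by rewrite /= !phiE ww'.
Qed.

Lemma psum_qsym n (A : set {ffun 'I_n -> nat}) (c : {ffun 'I_n -> nat} -> R) :
  (forall w w' : {ffun 'I_n -> nat}, (forall u v, (w u < w v)%N = (w' u < w' v)%N) ->
     A w -> A w' /\ c w' = c w) ->
  psum A c \in qsym_pred.
Proof.
move=> Ac; apply/qsym_predP; split; last first.
  exists n => m nm; apply: fsbig1 => w [_ /= wm].
  by rewrite -wm mdeg_mono ltnn in nm.
move=> k a i j a0 si sj.
have main (i' j' : k.-tuple nat) : sorted ltn i' -> sorted ltn j' ->
  exists2 phi : nat -> nat, map_tuple phi i' = j' &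
    forall x y, x \in i' -> y \in i' -> (x < y)%N = (phi x < phi y)%N.
  move=> si' sj'; exists (fun x => nth 0%N j' (index x i')).
    apply: eq_from_tnth => l; rewrite tnth_map !(tnth_nth 0%N) index_uniq ?size_tuple //.
    exact: (sorted_uniq ltn_trans ltnn).
  move=> x y xi yi.
  have nthE (s : k.-tuple nat) p q : sorted ltn s -> (p < k)%N -> (q < k)%N ->
      (nth 0%N s p < nth 0%N s q)%N = (p < q)%N.
    move=> ss pk qk; case: (ltngtP p q) => [pq|qp|->]; last by rewrite ltnn.
      by apply: (sorted_ltn_nth ltn_trans) => //; rewrite inE size_tuple.
    by apply/negbTE; rewrite -leqNgt ltnW //;
       apply: (sorted_ltn_nth ltn_trans) => //; rewrite inE size_tuple.
  rewrite -{1}(nth_index 0%N xi) -{1}(nth_index 0%N yi).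
  by rewrite !nthE // -[X in (_ < X)%N](size_tuple i') index_mem.
have [phi ij phi_lt] := main i j si sj.
have [psi ji psi_lt] := main j i sj si.
have phiE l : phi (tnth i l) = tnth j l by rewrite -[in RHS]ij tnth_map.
have psiE l : psi (tnth j l) = tnth i l by rewrite -[in RHS]ji tnth_map.
have phiK x : x \in i -> psi (phi x) = x.
  by move=> /tnthP[l ->]; rewrite phiE psiE.
have psiK x : x \in j -> phi (psi x) = x.
  by move=> /tnthP[l ->]; rewrite psiE phiE.
have word_in (i' : k.-tuple nat) (w : {ffun 'I_n -> nat}) v :
    mono w = xpow i' a -> w v \in i'.
  rewrite monoE xpowE => /mseqP /perm_mem /(_ (w v)); rewrite mem_word.
  move=> /esym /flattenP[_ /mapP[l _ ->]]; rewrite mem_nseq => /andP[_ /eqP ->].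
  exact: mem_tnth.
have mono_map (i' : k.-tuple nat) (h : nat -> nat) (w : {ffun 'I_n -> nat}) :
    mono w = xpow i' a -> mono [ffun v => h (w v)] = xpow (map_tuple h i') a.
  rewrite !monoE !xpowE xword_map => /mseqP /(perm_map h) /mseqP <-.
  congr mseq; rewrite /word -[RHS]map_comp; apply: seq.eq_map => v /=; by rewrite ffunE.
have move_word (i' : k.-tuple nat) (h : nat -> nat) (w : {ffun 'I_n -> nat}) :
    (forall x y, x \in i' -> y \in i' -> (x < y)%N = (h x < h y)%N) ->
    A w -> mono w = xpow i' a ->
    [/\ A [ffun v => h (w v)], c [ffun v => h (w v)] = c w
      & mono [ffun v => h (w v)] = xpow (map_tuple h i') a].
  move=> h_lt Aw wi.
  have hw u v : (w u < w v)%N = ([ffun v => h (w v)] u < [ffun v => h (w v)] v)%N.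
    by rewrite !ffunE; apply: h_lt; exact: word_in.
  by have [] := Ac _ _ hw Aw; split=> //; exact: mono_map.
pose ph (w : {ffun 'I_n -> nat}) : {ffun 'I_n -> nat} := [ffun v => phi (w v)].
apply/esym; rewrite /psum (@reindex_fsbig _ _ _ {ffun 'I_n -> nat} {ffun 'I_n -> nat} ph
  (A `&` [set w | mono w = xpow i a])%classic); last first.
  split.
  - move=> w [Aw /= wi]; have [Aw' _] := move_word _ _ _ phi_lt Aw wi.
    by rewrite ij; split.
  - move=> w w' /set_mem[_ /= wi] /set_mem[_ /= wi'] /ffunP ww'.
    apply/ffunP => v; have := ww' v; rewrite !ffunE => /(congr1 psi).
    by rewrite !phiK //; exact: word_in.
  - move=> w [Aw /= wj]; have [] := move_word _ _ _ psi_lt Aw wj.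
    rewrite ji => Aw' _ wi; exists [ffun v => psi (w v)] => //.
    by apply/ffunP => v; rewrite !ffunE psiK //; exact: word_in wj.
apply: eq_fsbigr => w /set_mem[Aw /= wi].
by have [] := move_word _ _ _ phi_lt Aw wi.
Qed.

End PowerSeries.

Arguments psum {R n}.

(* For k : 'I_n.-1, the positions k + 1 and k + 2 of [n] (k and k + 1 in 'I_n):
   k stands for the element k + 1 of [n-1]. *)
Definition posl n (k : 'I_n.-1) : 'I_n := widen_ord (leq_pred n) k.

Lemma posr_subproof n (k : 'I_n.-1) : (k.+1 < n)%N.
Proof. by rewrite -ltn_predRL. Qed.

Definition posr n (k : 'I_n.-1) : 'I_n := Ordinal (posr_subproof k).

Definition fund_word n (S : {set 'I_n.-1}) (w : {ffun 'I_n -> nat}) : bool :=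
  [forall k, if k \in S then w (posr k) < w (posl k)
             else w (posr k) <= w (posl k)]%N.

Section Fundamental.
Variable R : comNzRingType.

Lemma fundamental_subproof n (S : {set 'I_n.-1}) :
  psum [set w | fund_word S w] (fun=> 1) \in @qsym_pred R.
Proof.
apply: psum_qsym => w w' ww' /forallP Sw; split=> //=; apply/forallP => k.
have := Sw k; case: (k \in S); first by rewrite ww'.
by rewrite !(leqNgt (_ (posr k))) ww'.
Qed.

Definition fundamental n (S : {set 'I_n.-1}) : qsym R :=
  Qsym (fundamental_subproof S).

End Fundamental.

Arguments fundamental {R} n S.

Definition descents n (w : {ffun 'I_n -> nat}) : {set 'I_n.-1} :=
  [set k | (w (posr k) < w (posl k))%N].

Definition nonincr n (w : {ffun 'I_n -> nat}) : bool :=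
  [forall k : 'I_n.-1, w (posr k) <= w (posl k)]%N.

Lemma fund_wordE n (S : {set 'I_n.-1}) w :
  fund_word S w = nonincr w && (S \subset descents w).
Proof.
apply/forallP/andP => [Sw|[/forallP wn /fintype.subsetP Sd] k]; last first.
  by case: ifP => [/Sd|_ //]; rewrite inE.
split; first by apply/forallP => k; have := Sw k; case: ifP => // _ /ltnW.
by apply/fintype.subsetP => k kS; have := Sw k; rewrite kS inE.
Qed.

(* A nonincreasing word with descent set T. *)
Definition descent_word n (T : {set 'I_n.-1}) : {ffun 'I_n -> nat} :=
  [ffun i : 'I_n => #|[set k in T | (i <= k)%N]|].

Lemma descent_wordE n (T : {set 'I_n.-1}) k :
  descent_word T (posl k) = ((k \in T) + descent_word T (posr k))%N.
Proof.
rewrite !ffunE (cardsD1 k) !(finset.in_set, inE) /= leqnn andbT; congr (_ + _)%N.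
apply: eq_card => l; rewrite !(finset.in_set, inE) /= ltn_neqAle (inj_eq val_inj) eq_sym.
by rewrite andbCA.
Qed.

Lemma nonincr_descent_word n (T : {set 'I_n.-1}) : nonincr (descent_word T).
Proof. by apply/forallP => k; rewrite descent_wordE leq_addl. Qed.

Lemma descents_descent_word n (T : {set 'I_n.-1}) : descents (descent_word T) = T.
Proof.
apply/setP => k; rewrite inE descent_wordE.
by case: (k \in T); rewrite ?ltnn ?add0n ?ltnn // add1n leqnn.
Qed.

(* Two nonincreasing words with the same descents are order equivalent. *)
Lemma nonincr_le n (w w' : {ffun 'I_n -> nat}) :
  nonincr w -> nonincr w' -> descents w = descents w' ->
  forall i j : 'I_n, (i <= j)%N ->
    [/\ (w j <= w i)%N, (w' j <= w' i)%N & (w j == w i) = (w' j == w' i)].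
Proof.
move=> /forallP wn /forallP wn' /setP dww' i j.
move=> /subnKC; move: (j - i)%N => d; elim: d j => [|d IHd] j ij.
  have -> : j = i by apply: val_inj; rewrite /= -ij addn0.
  by rewrite !leqnn !eqxx.
have kn : ((i + d) < n.-1)%N by rewrite ltn_predRL -addnS ij.
pose k := Ordinal kn.
have jk : j = posr k by apply: val_inj; rewrite /= -ij addnS.
have [] := IHd (posl k) erefl; have := dww' k; rewrite !inE -jk.
have := wn k; have := wn' k; rewrite -jk.
move: (w j) (w i) (w (posl k)) (w' j) (w' i) (w' (posl k)) => a b c a' b' c'.
move=> a'c' ac acE cb cb' cbE; split; [lia | lia |].
by apply/eqP/eqP => [ab|ab]; lia.
Qed.

Lemma nonincr_order n (w w' : {ffun 'I_n -> nat}) :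
  nonincr w -> nonincr w' -> descents w = descents w' ->
  forall u v, (w u < w v)%N = (w' u < w' v)%N.
Proof.
move=> wn wn' dww' u v; case/orP: (leq_total u v) => uv.
  by have [wv wv' _] := nonincr_le wn wn' dww' uv; lia.
have [wv wv' eqw] := nonincr_le wn wn' dww' uv.
by rewrite !ltn_neqAle wv wv' eqw.
Qed.

Lemma nonincr_sorted n (w : {ffun 'I_n -> nat}) :
  nonincr w -> sorted geq (word w).
Proof.
move=> wn; rewrite sorted_map.
have : sorted (relpre val ltn) (enum 'I_n).
  by rewrite -sorted_map val_enum_ord iota_ltn_sorted.
apply: sub_sorted => i j /= ij.
by have [] := nonincr_le wn wn erefl (ltnW ij).
Qed.

Lemma nonincr_inj n (w w' : {ffun 'I_n -> nat}) :
  nonincr w -> nonincr w' -> mono w = mono w' -> w = w'.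
Proof.
move=> wn wn'; rewrite !monoE => /mseqP ww'.
have /eq_in_map eww' : word w = word w'.
  apply: (sorted_eq (leT := geq)) ww'; try exact: nonincr_sorted.
    by move=> x y z /= xy yz; exact: leq_trans yz xy.
  by move=> x y /= xy; apply/eqP; rewrite eqn_leq andbC.
by apply/ffunP => v; apply: eww'; rewrite mem_enum.
Qed.

Lemma nonincr_mono n m : mdeg m = n ->
  exists2 w : {ffun 'I_n -> nat}, nonincr w & mono w = m.
Proof.
move=> mn.
have [s ms] : exists s, m = mseq s.
  exists (flatten [seq nseq (m x) x | x <- finsupp m]).
  apply/eqP/cmP => x; rewrite mseqE count_flatten -map_comp sumnE big_map.
  rewrite (eq_bigr (fun y => ((y == x) * m y)%N)) => [|y _]; last by rewrite /= count_nseq.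
  case: (finsuppP m x) => [xm|xm].
    rewrite big_seq big1 // => y ym; case: eqP => // yx; by rewrite -yx ym in xm.
  by rewrite (big_fsetD1 x) //= eqxx mul1n big_seq big1 ?addn0 // => y;
     rewrite !inE => /andP[/negPf ->].
pose t := sort geq s.
have st : size t = n by rewrite size_sort -mn ms mdeg_mseq.
have tt : sorted geq t.
  by apply: sort_sorted => x y; exact: leq_total.
exists [ffun i : 'I_n => nth 0%N t i].
  apply/forallP => k; rewrite !ffunE /=.
  move/(sortedP 0%N): tt; apply; rewrite st; exact: posr_subproof.
rewrite monoE ms; apply/mseqP.
have -> : word [ffun i : 'I_n => nth 0%N t i] = t.
  apply: (@eq_from_nth _ 0%N) => [|i]; rewrite size_word // => ni.
  by rewrite /word (nth_map (Ordinal ni)) ?size_enum_ord // ffunE nth_enum_ord.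
by rewrite perm_sort.
Qed.

Section FundamentalTheory.
Variable R : comNzRingType.

Lemma fundamental_mono n (S : {set 'I_n.-1}) w : nonincr w ->
  fundamental (R := R) n S (mono w) = (S \subset descents w)%:R.
Proof.
move=> wn; rewrite /qcoef /= /psum; have [Sw|Sw] := boolP (S \subset descents w).
  rewrite (_ : (_ `&` _)%classic = [set w]%classic) ?fsbig_set1 //.
  apply/seteqP; split => [w' [/= + ww']|w' -> /=].
    by rewrite fund_wordE => /andP[wn' _]; exact: nonincr_inj.
  by split=> //=; rewrite fund_wordE wn.
rewrite (_ : (_ `&` _)%classic = set0%classic) ?fsbig_set0 //.
apply/seteqP; split => // w' [/= + ww'].
rewrite fund_wordE => /andP[wn' Sw'].
by rewrite (nonincr_inj wn' wn ww') (negPf Sw) in Sw'.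
Qed.

Lemma fundamental_deg n (S : {set 'I_n.-1}) m : mdeg m != n ->
  fundamental (R := R) n S m = 0.
Proof.
move=> mn; apply: fsbig1 => w [_ /= wm].
by rewrite -wm mdeg_mono eqxx in mn.
Qed.

Lemma sum_sign_interval (T : finType) (A B : {set T}) :
  \sum_(U : {set T} | (A \subset U) && (U \subset B)) (-1) ^+ #|B :\: U|
    = (A == B)%:R :> R.
Proof.
have [AB|AB] := boolP (A \subset B); last first.
  rewrite big_pred0 => [|U]; last first.
    by apply: contraNF AB => /andP[]; exact: fintype.subset_trans.
  by case: eqP AB => // ->; rewrite fintype.subxx.
have [eqAB|neqAB] := eqVneq A B.
  rewrite -eqAB (big_pred1 A) => [|U]; last by rewrite /= finset.eqEsubset andbC.
  by rewrite finset.setDv cards0.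
have /fintype.subsetPn[x xB xA] : ~~ (B \subset A).
  by move: neqAB; rewrite finset.eqEsubset AB.
rewrite (bigID (fun U : {set T} => x \in U)) /=.
rewrite (reindex_onto (fun U : {set T} => x |: U) (fun U => U :\ x)) /=; last first.
  by move=> U /andP[_ xU]; rewrite finset.setD1K.
apply/eqP; rewrite addr_eq0 -sumrN; apply/eqP/eq_big => U.
  have [xU|xU] := boolP (x \in U).
    rewrite andbF; apply/negbTE; rewrite negb_and orbC; apply/orP; left.
    by apply: contraTneq xU => <-; rewrite finset.setD11.
  rewrite finset.setU1K // eqxx finset.setU11 !andbT finset.subUset finset.sub1set xB /=.
  congr (_ && _); apply/fintype.subsetP/fintype.subsetP => AU y yA.
    by have := AU y yA; rewrite finset.in_setU1; case: eqP => // yx; rewrite -yx yA in xA.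
  by rewrite finset.in_setU1 AU ?orbT.
move=> /andP[_ /eqP UE]; have xU : x \notin U by rewrite -UE finset.setD11.
rewrite (cardsD1 x (B :\: U)) finset.in_setD xU xB exprS mulN1r opprK.
by rewrite finset.setDDl finset.setUC.
Qed.

Lemma sum_sign_intervalr (T : finType) (A B : {set T}) :
  \sum_(U : {set T} | (A \subset U) && (U \subset B)) (-1) ^+ #|U :\: A|
    = (A == B)%:R :> R.
Proof.
transitivity ((-1) ^+ #|B :\: A| * (A == B)%:R : R); last first.
  by case: eqP => [->|_]; rewrite ?mulr0 // finset.setDv cards0 mulr1.
rewrite -sum_sign_interval mulr_sumr; apply: eq_bigr => U /andP[AU UB].
have := cardsID U (B :\: A).
rewrite (_ : (B :\: A) :&: U = U :\: A); last first.
  by rewrite finset.setIDAC (finset.setIidPr UB).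
rewrite (_ : (B :\: A) :\: U = B :\: U); last first.
  by rewrite finset.setDDl (finset.setUidPr AU).
by move=> <-; rewrite exprD -mulrA -expr2 sqrr_sign mulr1.
Qed.

(* The coefficient of f on F_{n,S}, by inclusion-exclusion from
   F_{n,S} = \sum_(T containing S) M_{n,T}, where M_{n,T} is the sum of the
   monomials x_{i_1} ... x_{i_n} with i_1 >= ... >= i_n and i_j > i_{j+1}
   exactly when j is in T; see fundamental_expansion. *)
Definition fund_coef (f : qsym R) n (S : {set 'I_n.-1}) : R :=
  \sum_(T : {set 'I_n.-1} | T \subset S)
    (-1) ^+ #|S :\: T| * f (mono (descent_word T)).

Lemma fund_coefK (f : qsym R) n (D : {set 'I_n.-1}) :
  \sum_(S : {set 'I_n.-1} | S \subset D) fund_coef f S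
    = f (mono (descent_word D)).
Proof.
rewrite (exchange_big_dep (fun T : {set 'I_n.-1} => T \subset D)) /=; last first.
  by move=> S T SD TS; exact: fintype.subset_trans TS SD.
rewrite (bigD1 D) //= [X in _ + X]big1 ?addr0 => [|T /andP[TD neqTD]].
  by rewrite -mulr_suml (eq_bigl _ _ (fun=> andbC _ _)) sum_sign_intervalr eqxx mul1r.
by rewrite -mulr_suml (eq_bigl _ _ (fun=> andbC _ _)) sum_sign_intervalr
  (negPf neqTD) mul0r.
Qed.

Lemma fund_coef_fundamental n (S T : {set 'I_n.-1}) :
  fund_coef (fundamental n S) T = (S == T)%:R.
Proof.
rewrite -sum_sign_interval /fund_coef big_mkcond [RHS]big_mkcond.
apply: eq_bigr => U _.
rewrite fundamental_mono ?nonincr_descent_word // descents_descent_word.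
by case: (S \subset U); case: (U \subset T); rewrite ?mulr1 ?mulr0.
Qed.

Lemma fund_coef_linear n (S : {set 'I_n.-1}) : scalar (fun f => fund_coef f S).
Proof.
move=> c f g; rewrite /fund_coef mulr_sumr -big_split; apply: eq_bigr => T _.
by rewrite qsymDE qsymZE mulrDr mulrCA.
Qed.

Lemma qsym_descents (f : qsym R) n (w : {ffun 'I_n -> nat}) : nonincr w ->
  f (mono w) = f (mono (descent_word (descents w))).
Proof.
move=> wn; apply: qsym_order; apply: nonincr_order => //.
  exact: nonincr_descent_word.
by rewrite descents_descent_word.
Qed.

Lemma qsym_fund_coef (f : qsym R) n m : mdeg m = n ->
  f m = \sum_(S : {set 'I_n.-1}) fund_coef f S * fundamental n S m.
Proof.
move=> mn; have [w wn <-] := nonincr_mono mn.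
rewrite qsym_descents // -fund_coefK [LHS]big_mkcond; apply: eq_bigr => S _.
by rewrite fundamental_mono //; case: ifP; rewrite ?mulr1 ?mulr0.
Qed.

Lemma fundamental_expansion (f : qsym R) d :
  (forall m, (d < mdeg m)%N -> f m = 0) ->
  f = \sum_(n < d.+1) \sum_(S : {set 'I_n.-1}) fund_coef f S *: fundamental n S.
Proof.
move=> fd; apply: qsymP => m; rewrite qsym_sumE.
have [dm|md] := ltnP d (mdeg m).
  rewrite fd // big1 // => n _; rewrite qsym_sumE big1 // => S _.
  rewrite qsymZE fundamental_deg ?mulr0 // neq_ltn orbC.
  by rewrite (leq_ltn_trans _ dm) // -ltnS.
rewrite -ltnS in md; rewrite (bigD1 (Ordinal md)) //= [X in _ + X]big1 ?addr0.
  by rewrite qsym_sumE (qsym_fund_coef _ erefl).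
move=> n neq; rewrite qsym_sumE big1 // => S _.
by rewrite qsymZE fundamental_deg ?mulr0 // eq_sym.
Qed.

Definition omega_part (f : qsym R) n : {cmonom nat} -> R :=
  fun m => \sum_(S : {set 'I_n.-1}) fund_coef f S * fundamental n (~: S) m.

Definition omega_series (f : qsym R) : {cmonom nat} -> R :=
  fun m => omega_part f (mdeg m) m.

Lemma omega_subproof f : omega_series f \in @qsym_pred R.
Proof.
apply/qsym_predP; split.
  move=> k a i j a0 si sj; rewrite /omega_series.
  have -> : mdeg (xpow i a) = mdeg (xpow j a).
    rewrite !xpowE !mdeg_mseq /xword !size_flatten /shape -!map_comp.
    by congr sumn; apply: seq.eq_map => l /=; rewrite !size_nseq.
  apply: eq_bigr => S _; congr (_ * _).
  exact: qsym_quasisymmetric.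
have [d fd] := qsym_bounded f; exists d => m dm; rewrite /omega_series.
by apply: big1 => S _; rewrite /fund_coef big1 ?mul0r // => T _;
   rewrite fd ?mulr0 ?mdeg_mono.
Qed.

Definition omega (f : qsym R) : qsym R := Qsym (omega_subproof f).

Lemma omegaE f m :
  omega f m = \sum_(S : {set 'I_(mdeg m).-1})
                fund_coef f S * fundamental (mdeg m) (~: S) m.
Proof. by []. Qed.

Lemma omega_linear : linear omega.
Proof.
move=> c f g; apply: qsymP => m.
rewrite qsymDE qsymZE !omegaE mulr_sumr -big_split /=.
by apply: eq_bigr => S _; rewrite fund_coef_linear mulrDl mulrA.
Qed.

HB.instance Definition _ := GRing.isLinear.Build R (qsym R) (qsym R) _ omega omega_linear.

Lemma omega_fundamental n (S : {set 'I_n.-1}) :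
  omega (fundamental n S) = fundamental n (~: S).
Proof.
apply: qsymP => m; rewrite omegaE.
have [mn|mn] := eqVneq (mdeg m) n; last first.
  rewrite fundamental_deg // big1 // => T _.
  rewrite /fund_coef big1 ?mul0r // => U _.
  by rewrite fundamental_deg ?mulr0 ?mdeg_mono // eq_sym.
rewrite mn (bigD1 S) //= fund_coef_fundamental eqxx mul1r big1 ?addr0 // => T.
by rewrite fund_coef_fundamental eq_sym => /negPf ->; rewrite mul0r.
Qed.

(* omega is the only linear map on QSym with omega_fundamental. *)
Lemma omega_unique (h : {linear qsym R -> qsym R}) :
  (forall n (S : {set 'I_n.-1}), h (fundamental n S) = fundamental n (~: S)) ->
  h =1 omega.
Proof.
move=> hF f; have [d fd] := qsym_bounded f.
rewrite (fundamental_expansion fd) !linear_sum; apply: eq_bigr => n _.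
by rewrite !linear_sum; apply: eq_bigr => S _; rewrite !linearZ /= hF omega_fundamental.
Qed.

Lemma omegaK : involutive omega.
Proof.
move=> f; have [d fd] := qsym_bounded f.
rewrite {2}(fundamental_expansion fd) [in LHS](fundamental_expansion fd).
rewrite !linear_sum; apply: eq_bigr => n _.
rewrite !linear_sum; apply: eq_bigr => S _.
by rewrite !linearZ /= !omega_fundamental finset.setCK.
Qed.

End FundamentalTheory.

(* With 'X as the parameter t, qsym {poly R} is the module of polynomials in t
   with coefficients in qsym R (qcoeft_bounded), and its operator omega is the
   coefficientwise extension of the one of qsym R (qcoeft_omega). *)
Section PolynomialCoefficients.
Variable R : comNzRingType.

Lemma qcoeft_subproof k (f : qsym {poly R}) :
  (fun m => (f m)`_k) \in @qsym_pred R.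
Proof.
apply/qsym_predP; split=> [l a i j a0 si sj|].
  by rewrite (qsym_quasisymmetric f a0 si sj).
by have [d fd] := qsym_bounded f; exists d => m dm; rewrite fd ?coef0.
Qed.

Definition qcoeft k (f : qsym {poly R}) : qsym R := Qsym (qcoeft_subproof k f).

Lemma qcoeftE k f m : qcoeft k f m = (f m)`_k. Proof. by []. Qed.

Lemma qcoeft_bounded (f : qsym {poly R}) :
  exists N, forall k, (N <= k)%N -> qcoeft k f = 0.
Proof.
have [d fd] := qsym_bounded f.
exists (\max_(n < d.+1) \max_(T : {set 'I_n.-1}) size (f (mono (descent_word T)))).
move=> k Nk; apply: qsymP => m; rewrite qcoeftE qsym0E.
have [dm|] := ltnP d (mdeg m); first by rewrite fd ?coef0.
rewrite -ltnS => md; have [w wn <-] := nonincr_mono (erefl (mdeg m)).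
rewrite qsym_descents // nth_default // (leq_trans _ Nk) //.
rewrite (bigmax_sup (Ordinal md)) //=.
exact: (bigmax_sup (descents w)).
Qed.

Lemma qcoeft_omega k f : qcoeft k (omega f) = omega (qcoeft k f).
Proof.
apply: qsymP => m; rewrite qcoeftE !omegaE coef_sum; apply: eq_bigr => S _.
have [b -> ->] : exists2 b : bool,
    fundamental (R := {poly R}) (mdeg m) (~: S) m = b%:R
    & fundamental (R := R) (mdeg m) (~: S) m = b%:R.
  have [w wn wm] := nonincr_mono (erefl (mdeg m)).
  by exists (~: S \subset descents w); rewrite -[X in _ _ X = _]wm fundamental_mono.
suff -> : fund_coef (qcoeft k f) S = (fund_coef f S)`_k.
  by case: b; rewrite ?mulr1 // ?mulr0 ?coef0.
rewrite coef_sum; apply: eq_bigr => T _.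
by rewrite qcoeftE -signr_odd -[(-1) ^+ _ in RHS]signr_odd; case: odd; rewrite ?expr1 ?expr0 ?mulN1r ?mul1r ?coefN.
Qed.

End PolynomialCoefficients.

(* A digraph on [n] is its set of edges E : {set 'I_n * 'I_n}; the vertex
   v : 'I_n stands for v + 1. *)
Section Digraph.
Variables (n : nat) (E : {set 'I_n * 'I_n}).

Definition adj : rel 'I_n := fun u v => ((u, v) \in E) || ((v, u) \in E).

Definition proper_coloring (kappa : {ffun 'I_n -> nat}) : bool :=
  [forall u, forall v, adj u v ==> (kappa u != kappa v)].

Definition asc (kappa : {ffun 'I_n -> nat}) : nat :=
  #|[set e in E | (kappa e.1 < kappa e.2)%N]|.

Lemma chromatic_subproof :
  psum [set kappa | proper_coloring kappa]
       (fun kappa => 'X^(asc kappa) : {poly rat}) \in @qsym_pred {poly rat}.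
Proof.
apply: psum_qsym => w w' ww' /forallP pw; split; last first.
  congr ('X^ _); apply: eq_card => e; rewrite !(finset.in_set, inE) /=.
  by rewrite ww'.
apply/forallP => u; apply/forallP => v; apply/implyP => uv.
have := implyP (forallP (pw u) v) uv.
by rewrite !neq_ltn !ww'.
Qed.

Definition chromatic_qsym : qsym {poly rat} := Qsym chromatic_subproof.

Implicit Types s : 'S_n.

Definition inv_digraph s : nat :=
  #|[set e in E | ((s^-1)%g e.2 < (s^-1)%g e.1)%N]|.

(* P is the set of positions i_1 < ... < i_k of the subword. *)
Definition subword s (P : {set 'I_n}) : seq 'I_n := [seq s i | i <- enum P].

Definition rank s (x : 'I_n) : nat :=
  \max_(P : {set 'I_n} |
        if subword s P is y :: p then path adj y p && (last y p == x) else false)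
    size (subword s P).

Definition DES s : {set 'I_n.-1} :=
  [set k | let a := s (posl k) in let b := s (posr k) in
           (rank s b < rank s a)%N || ((rank s a == rank s b) && (b < a)%N)].

End Digraph.

(* Main.v *)
(* Since omega is an involution, it suffices to expand the chromatic function
   itself over the F_{n,S} with S the complement of DES_G(sigma).  Compare the
   coefficients at the monomial of a nonincreasing word w: sigma contributes iff
   every index that is not a G-descent is a descent of w.  Assigning to sigma_i
   the color w_i turns such a sigma into a coloring kappa with the same monomial,
   and the edges counted by inv become those counted by asc.  The condition on
   sigma says that the triples (kappa, rank, label) strictly decrease along
   sigma.  Hence kappa is proper, because the rank increases along an edge of G.
   Conversely, for proper kappa the ranks depend only on the orientation of G
   induced by kappa, so exactly one sigma sorts the triples. *)
Require Import Defs.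
From mathcomp Require Import all_boot all_order all_algebra all_fingroup.
From mathcomp Require Import all_classical zify.
From mathcomp.multinomials Require Import monalg.

Set Implicit Arguments.
Unset Strict Implicit.
Unset Printing Implicit Defensive.

Import GRing.Theory.

Local Open Scope ring_scope.

(** * Sorting permutations and lexicographic keys *)

Section PermutationsAndKeys.
Variable n : nat.
Implicit Types (s : 'S_n) (f h : 'I_n -> nat).

Lemma enum_ord_sorted : sorted (relpre val ltn) (enum 'I_n).
Proof. by rewrite -sorted_map val_enum_ord iota_ltn_sorted. Qed.

Lemma decreasing_lt h : (forall k : 'I_n.-1, h (posr k) < h (posl k))%N ->
  forall i j : 'I_n, (i < j)%N -> (h j < h i)%N.
Proof.
move=> hd i j /subnKC; move: (j - i.+1)%N => d; elim: d j => [|d IHd] j ij.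
  have kn : (i < n.-1)%N by rewrite ltn_predRL -[X in (X < _)%N]addn0 ij.
  have := hd (Ordinal kn); congr (h _ < h _)%N; apply: val_inj => //=.
  by rewrite -ij addn0.
have kn : (i.+1 + d < n.-1)%N by rewrite ltn_predRL -addnS ij.
have := IHd (posl (Ordinal kn)) erefl; apply: leq_ltn_trans; apply: ltnW.
have := hd (Ordinal kn); congr (h _ < _)%N; apply: val_inj => /=.
by rewrite -ij addnS.
Qed.

(** Each vertex gets as position the number of vertices with a larger value of [f]. Injectivity of
    [f] makes these positions distinct, and [s] is the inverse of this map. *)
Lemma exists_decreasing_perm f : injective f ->
  exists s, forall i j : 'I_n, (i < j)%N -> (f (s j) < f (s i))%N.
Proof.
move=> f_inj; pose above u := [set v | (f u < f v)%N].
have above_lt u v : (f u < f v)%N -> (#|above v| < #|above u|)%N.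
  move=> uv; apply/proper_card/properP; split.
    by apply/fintype.subsetP => x; rewrite !finset.inE; exact: ltn_trans.
  by exists v; rewrite !finset.inE ?ltnn.
have above_n u : (#|above u| < n)%N.
  rewrite -[X in (_ < X)%N]card_ord -cardsT; apply/proper_card/properP.
  by split; [exact: finset.subsetT | exists u; rewrite !finset.inE ?ltnn].
have g_inj : injective (fun u => Ordinal (above_n u)).
  move=> u v [uv]; apply: f_inj; case: (ltngtP (f u) (f v)) => // /above_lt.
    by rewrite uv ltnn.
  by rewrite uv ltnn.
exists (perm g_inj)^-1%g => i j ij.
have posE x : #|above ((perm g_inj)^-1%g x)| = x :> nat.
  by rewrite -[RHS](congr1 val (permKV (perm g_inj) x)) permE.
rewrite ltnNge; apply: contraTN ij; rewrite leq_eqVlt -(posE i) -(posE j).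
case/orP => [/eqP/f_inj ->|/above_lt]; first by rewrite ltnn.
by rewrite -leqNgt => /ltnW.
Qed.

Lemma decreasing_perm_inj f s s' :
  (forall i j : 'I_n, (i < j)%N -> (f (s j) < f (s i))%N) ->
  (forall i j : 'I_n, (i < j)%N -> (f (s' j) < f (s' i))%N) -> s = s'.
Proof.
move=> fs fs'; apply/permP => i.
suff /eq_in_map : map s (enum 'I_n) = map s' (enum 'I_n).
  by apply; rewrite mem_enum.
apply: (irr_sorted_eq (leT := relpre f gtn)).
- by move=> x y z /= yx xz; exact: ltn_trans xz yx.
- by move=> x /=; rewrite ltnn.
- by rewrite sorted_map; apply: sub_sorted enum_ord_sorted => ? ?; exact: fs.
- by rewrite sorted_map; apply: sub_sorted enum_ord_sorted => ? ?; exact: fs'.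
move=> x; apply/mapP/mapP => _.
  by exists (s'^-1%g x); rewrite ?mem_enum ?permKV.
by exists (s^-1%g x); rewrite ?mem_enum ?permKV.
Qed.

(* Orders pairs (a, b) with b < c lexicographically. *)
Definition lex2 (c a b : nat) : nat := (a * c + b)%N.

Lemma ltn_lex2 c a b a' b' : (b < c)%N -> (b' < c)%N ->
  (lex2 c a b < lex2 c a' b')%N = (a < a')%N || ((a == a') && (b < b')%N).
Proof.
rewrite /lex2 => bc b'c; case: (ltngtP a a') => [aa'|a'a|->] /=.
- by apply/idP; nia.
- by apply/negbTE; rewrite -leqNgt; nia.
- by rewrite ltn_add2l.
Qed.

Lemma eqn_lex2 c a b a' b' : (b < c)%N -> (b' < c)%N ->
  (lex2 c a b == lex2 c a' b') = (a == a') && (b == b').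
Proof.
move=> bc b'c; rewrite eqn_leq [X in X && _]leqNgt [X in _ && X]leqNgt !ltn_lex2 //.
by case: (ltngtP a a'); case: (ltngtP b b').
Qed.

End PermutationsAndKeys.

(** * Ranks as longest paths in the orientation of G by order of appearance *)

Section Rank.
Variables (n : nat) (E : {set 'I_n * 'I_n}).
Implicit Types (s : 'S_n) (u v x : 'I_n).

Definition before s : rel 'I_n := fun u v => ((s^-1)%g u < (s^-1)%g v)%N.

Definition edge_before s : rel 'I_n := fun u v => adj E u v && before s u v.

Lemma before_trans s : transitive (before s).
Proof. by move=> x u v; exact: ltn_trans. Qed.

Lemma adjC u v : adj E u v = adj E v u.
Proof. by rewrite /adj orbC. Qed.

Lemma subword_sorted s (P : {set 'I_n}) : sorted (before s) (subword s P).
Proof.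
rewrite sorted_map.
have -> : enum P = [seq i <- enum 'I_n | i \in P].
  by rewrite {1}/enum_mem -enumT.
apply: sorted_filter; first by move=> x u v; exact: ltn_trans.
apply: sub_sorted (enum_ord_sorted n) => i j /=.
by rewrite /before !permK.
Qed.

(** Turns a list of vertices in order of appearance into one of the position sets over which [rank]
    maximizes. *)
Lemma sorted_subword s (l : seq 'I_n) : sorted (before s) l ->
  subword s [set i | s i \in l] = l.
Proof.
move=> sl; apply: (irr_sorted_eq (@before_trans s)) sl _.
- by move=> x; rewrite /before ltnn.
- exact: subword_sorted.
move=> x; apply/mapP/idP => [[i + ->]|xl].
  by rewrite mem_enum finset.inE.
by exists (s^-1%g x); rewrite ?mem_enum ?finset.inE ?permKV.
Qed.

(** Together with [rank_chain], this replaces position sets by [edge_before] paths: the rank of a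
    vertex is the largest number of vertices on such a path ending there. *)
Lemma rank_ge s x p : path (edge_before s) x p ->
  (size (x :: p) <= rank E s (last x p))%N.
Proof.
move=> xp.
have xpE : subword s [set i | s i \in x :: p] = x :: p.
  by apply: sorted_subword; apply: sub_path xp => u v /andP[].
rewrite -{1}xpE; apply: (leq_bigmax_cond (F := fun P => size (subword s P))).
by rewrite xpE eqxx andbT; apply: sub_path xp => u v /andP[].
Qed.

Lemma rank_chain s x : exists y p,
  [/\ path (edge_before s) y p, last y p = x & rank E s x = size (y :: p)].
Proof.
pose C (P : {set 'I_n}) :=
  if subword s P is y :: p then path (adj E) y p && (last y p == x) else false.
have C_gt0 : (0 < #|C|)%N.
  (* The one-letter subword [x] is admissible, so the maximum is attained and is not the default 0
     of an empty maximum. *)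
  apply/card_gt0P; exists [set i | s i \in [:: x]].
  suff: C [set i | s i \in [:: x]] by [].
  by rewrite /C sorted_subword //= eqxx.
have [P PC rankP] := eq_bigmax_cond (fun P => size (subword s P)) C_gt0.
rewrite [rank E s x]rankP.
have : C P := PC.
move: (subword_sorted s P); rewrite /C.
case: (subword s P) => // y p sp /andP[yp /eqP yx]; exists y, p; split=> //.
elim: p y yp sp {yx} => //= z p IHp y /andP[yz zp] /andP[byz bzp].
by rewrite /edge_before yz byz IHp.
Qed.

Lemma rank_lt s u v : adj E u v -> before s u v -> (rank E s u < rank E s v)%N.
Proof.
move=> auv buv; have [y [p [yp yu ->]]] := rank_chain s u.
(* A longest path ending at [u] is extended by [v]. *)
have := @rank_ge s y (rcons p v); rewrite last_rcons /= size_rcons; apply.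
by rewrite rcons_path yp yu /edge_before auv.
Qed.

Lemma eq_rank s s' : edge_before s =2 edge_before s' -> rank E s =1 rank E s'.
Proof.
move=> ss' x; apply/eqP; rewrite eqn_leq; apply/andP; split.
  have [y [p [yp <- ->]]] := rank_chain s x.
  by apply: rank_ge; rewrite -(eq_path ss').
have [y [p [yp <- ->]]] := rank_chain s' x.
by apply: rank_ge; rewrite (eq_path ss').
Qed.

Lemma rank_le s x : (rank E s x <= n)%N.
Proof.
apply/bigmax_leqP => P _; rewrite size_map -cardE -[X in (_ <= X)%N]card_ord.
exact: max_card.
Qed.

End Rank.

(** * The bijection between permutations and proper colorings *)

Section Bijection.
Variables (n : nat) (E : {set 'I_n * 'I_n}).
Hypothesis loopless : forall v : 'I_n, (v, v) \notin E.
Implicit Types (s : 'S_n) (u v x : 'I_n) (w kappa : {ffun 'I_n -> nat}).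

(* Lexicographic in (kappa u, rho u, u); the radix n.+1 is valid because ranks
   are at most n. *)
Definition key kappa (rho : 'I_n -> nat) u : nat :=
  lex2 n (lex2 n.+1 (kappa u) (rho u)) u.

Lemma key_inj kappa rho : injective (key kappa rho).
Proof.
move=> u v; rewrite /key /lex2 => uv; apply: val_inj => /=.
(* The residue of a key modulo [n] is the label of the vertex. *)
have := congr1 (modn^~ n) uv; rewrite !modnMDl !modn_small //.
Qed.

Lemma lt_key kappa rho u v : (forall x, rho x <= n)%N ->
  (key kappa rho u < key kappa rho v)%N =
  (kappa u < kappa v)%N || ((kappa u == kappa v) &&
     ((rho u < rho v)%N || ((rho u == rho v) && (u < v)%N))).
Proof.
move=> rn; rewrite /key ltn_lex2 // ltn_lex2 ?ltnS // eqn_lex2 ?ltnS //.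
by case: (ltngtP (kappa u) (kappa v)); case: (ltngtP (rho u) (rho v)).
Qed.

Definition place w s : {ffun 'I_n -> nat} := [ffun u => w (s^-1 u)%g].

Lemma placeE w s i : place w s (s i) = w i.
Proof. by rewrite ffunE permK. Qed.

Lemma mono_place w s : mono (place w s) = mono w.
Proof.
rewrite !monoE; apply/mseqP.
have -> : word (place w s) = map w (map (s^-1)%g (enum 'I_n)).
  by rewrite -map_comp; apply: eq_map => u /=; rewrite ffunE.
apply/perm_map/uniq_perm; rewrite ?(map_inj_uniq perm_inj) ?enum_uniq //.
move=> u; rewrite mem_enum; apply/mapP; exists (s u); rewrite ?mem_enum ?permK //.
Qed.

Lemma place_le w s u v : nonincr w -> before s u v -> (place w s v <= place w s u)%N.
Proof. by move=> wn uv; rewrite !ffunE; have [] := nonincr_le wn wn erefl (ltnW uv). Qed.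

Lemma before_total s u v : u != v -> before s u v = ~~ before s v u.
Proof.
move=> uv; rewrite /before -leqNgt ltn_neqAle.
by rewrite (inj_eq val_inj) (inj_eq perm_inj) uv.
Qed.

Lemma adj_neq u v : adj E u v -> u != v.
Proof. by rewrite /adj; case: eqP => // ->; rewrite orbb (negPf (loopless v)). Qed.

(** Colors weakly decrease along [s], and properness makes this strict across an edge. So the
    coloring alone determines the orientation [edge_before], hence the ranks. *)
Lemma place_adj_lt w s u v : nonincr w -> proper_coloring E (place w s) ->
  adj E u v -> before s u v = (place w s v < place w s u)%N.
Proof.
move=> wn /forallP/(_ u)/forallP/(_ v)/implyP pw auv; have := pw auv.
rewrite neq_ltn; have [buv|] := boolP (before s u v).
  by rewrite ltnNge place_le.
rewrite before_total ?adj_neq // negbK => bvu.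
by rewrite [X in _ || X]ltnNge place_le //= orbF => /ltnW; rewrite ltnNge => ->.
Qed.

(** It suffices to compare consecutive positions: the key drops there if the color does, and when
    the colors tie, the comparison of rank and label is exactly the condition for a G-descent. *)
Lemma key_decreasingP w s : nonincr w ->
  reflect (forall i j : 'I_n, (i < j)%N ->
             (key (place w s) (rank E s) (s j) < key (place w s) (rank E s) (s i))%N)
    (~: DES E s \subset descents w).
Proof.
move=> wn; have step k : (key (place w s) (rank E s) (s (posr k))
      < key (place w s) (rank E s) (s (posl k)))%N
    = ~~ ((k \notin DES E s) && (k \notin descents w)).
  rewrite lt_key; last exact: rank_le.
  rewrite !placeE !finset.inE /= negb_and !negbK orbC.
  have /forallP/(_ k) := wn; rewrite leq_eqVlt (eq_sym (rank E s (s (posl k)))).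
  by case: ltngtP; rewrite //= ?orbT ?orbF.
apply: (iffP fintype.subsetP) => [Dw|kd k].
  apply: decreasing_lt => k; rewrite step negb_and negbK.
  have := Dw k; rewrite finset.in_setC; case: (k \in DES E s) => //=.
  by rewrite negbK => ->.
rewrite finset.in_setC => kD; have := kd (posl k) (posr k) (ltnSn _).
by rewrite step kD /= negbK.
Qed.

Lemma place_proper w s : nonincr w -> ~: DES E s \subset descents w ->
  proper_coloring E (place w s).
Proof.
move=> wn /(key_decreasingP s wn) kd.
have lt_neq u v : adj E u v -> before s u v -> place w s u != place w s v.
  move=> auv buv; have := kd _ _ buv; rewrite !permKV.
  rewrite lt_key; last exact: rank_le.
  case/orP => [|/andP[_]]; first by rewrite neq_ltn orbC => ->.
  (* With equal colors the decreasing key would keep the rank from increasing from [u] to [v]. *)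
  by have := rank_lt auv buv; case: ltngtP.
apply/forallP => u; apply/forallP => v; apply/implyP => auv.
have [buv|] := boolP (before s u v); first exact: lt_neq.
rewrite before_total ?adj_neq // negbK => bvu; rewrite eq_sym.
by apply: lt_neq => //; rewrite adjC.
Qed.

Lemma edge_before_place w s s' : nonincr w -> proper_coloring E (place w s) ->
  place w s = place w s' -> edge_before E s =2 edge_before E s'.
Proof.
move=> wn pw ss' u v; rewrite /edge_before; case: (boolP (adj E u v)) => //= auv.
by rewrite (place_adj_lt wn) // (place_adj_lt wn) -?ss'.
Qed.

(** The common coloring gives both permutations the same ranks, so both sort the vertices by the
    same injective key. *)
Lemma place_inj w s s' : nonincr w ->
  ~: DES E s \subset descents w -> ~: DES E s' \subset descents w ->
  place w s = place w s' -> s = s'.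
Proof.
move=> wn sD s'D ss'.
have eb := edge_before_place wn (place_proper wn sD) ss'.
apply: (decreasing_perm_inj (key_decreasingP s wn sD)) => i j ij.
have := key_decreasingP s' wn s'D _ _ ij; rewrite /key -ss'.
by rewrite !(eq_rank eb).
Qed.

(* The permutation must sort the vertices by a key involving its own rank
   function; as this depends only on kappa, it can be read off any permutation
   s0 along which kappa is nonincreasing. *)
Lemma place_surj w kappa : nonincr w -> proper_coloring E kappa ->
  mono kappa = mono w ->
  exists2 s, ~: DES E s \subset descents w & place w s = kappa.
Proof.
move=> wn pk kw.
have sorts rho : (forall x, rho x <= n)%N -> exists2 s, place w s = kappa &
    forall i j : 'I_n, (i < j)%N -> (key kappa rho (s j) < key kappa rho (s i))%N.
  move=> rn; have [s sd] := exists_decreasing_perm (@key_inj kappa rho).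
  exists s => //.
  have kn : nonincr [ffun i => kappa (s i)].
    apply/forallP => k; rewrite !ffunE.
    have := sd (posl k) (posr k) (ltnSn _); rewrite lt_key //.
    by case/orP => [/ltnW|/andP[/eqP ->]].
  have kE : place [ffun i => kappa (s i)] s = kappa.
    by apply/ffunP => u; rewrite !ffunE permKV.
  (* Both words are nonincreasing with the same monomial, so they coincide. *)
  have <- : [ffun i => kappa (s i)] = w; last exact: kE.
  by apply: nonincr_inj => //; rewrite -kw -[in RHS]kE mono_place.
(* A constant rank breaks color ties by label alone, which suffices to get some [s0]. *)
have [s0 s0k _] := sorts (fun=> 0%N) (fun=> isT).
have [s sk sd] := sorts (rank E s0) (rank_le E s0).
exists s => //; apply/key_decreasingP => // i j ij.
have eb : edge_before E s =2 edge_before E s0.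
  by apply: (edge_before_place wn); rewrite ?sk ?s0k.
by rewrite /key sk !(eq_rank eb); exact: sd.
Qed.

Lemma asc_place w s : nonincr w -> proper_coloring E (place w s) ->
  asc E (place w s) = inv_digraph E s.
Proof.
move=> wn pw; apply: eq_card => -[u v]; rewrite !finset.inE /=.
have [uvE|//] := boolP ((u, v) \in E); rewrite /= -(place_adj_lt wn pw) //.
by rewrite /adj uvE orbT.
Qed.

Lemma chromatic_qsymE m : chromatic_qsym E m =
  \sum_(s : 'S_n) 'X^(inv_digraph E s) * fundamental n (~: DES E s) m.
Proof.
have [mn|mn] := eqVneq (mdeg m) n; last first.
  rewrite big1 => [|s _]; last by rewrite fundamental_deg // mulr0.
  by apply: fsbig1 => w [_ /= wm]; rewrite -wm mdeg_mono eqxx in mn.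
have [w wn <-] := nonincr_mono mn.
rewrite (eq_bigr (fun s => if ~: DES E s \subset descents w
    then 'X^(inv_digraph E s) else 0)) => [|s _]; last first.
  by rewrite fundamental_mono //; case: ifP; rewrite ?mulr1 ?mulr0.
rewrite -big_mkcond /qcoef /= /psum.
rewrite (bigfs _ (index_enum_uniq _)) => [|s _]; last by rewrite mem_index_enum.
(* [place w] matches the contributing permutations with the proper colorings of monomial
   [mono w]. *)
rewrite (@reindex_fsbig _ _ _ _ _ (place w)
  [set` [pred s | ~: DES E s \subset descents w]]).
  apply: eq_fsbigr => s /set_mem /= sD; rewrite asc_place //; exact: place_proper.
split=> [s /= sD|s s' /set_mem /= sD /set_mem /= s'D|kappa [/= pk kw]].
- by split; [exact: place_proper | exact: mono_place].
- exact: place_inj.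
- by have [s sD sk] := place_surj wn pk kw; exists s.
Qed.

End Bijection.

Theorem theorem4 (n : nat) (n_ge1 : (1 <= n)%N) (E : {set 'I_n * 'I_n})
    (loopless : forall v : 'I_n, (v, v) \notin E) :
  omega (chromatic_qsym E) =
  \sum_(s : 'S_n) 'X^(inv_digraph E s) *: fundamental n (DES E s).
Proof.
apply: (inv_inj (@omegaK _)); rewrite omegaK linear_sum; apply: qsymP => m.
rewrite qsym_sumE chromatic_qsymE //; apply: eq_bigr => s _.
rewrite -qsymZE -omega_fundamental; congr (qcoef _ m).
exact/esym/linearZ.
Qed.
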